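(* Let $p>0$. The inequality $$I_0(t)>(\cosh pt)^{1/(2p^2)}$$ holds for all $t>0$ if and only if $p\ge\sqrt6/4$ ($\approx 0.61237$). The reverse inequality $I_0(t)<(\cosh pt)^{1/(2p^2)}$ holds for all $t>0$ if and only if $p\in(0,1/2]$. In particular, for all $t>0$, $$\sqrt{\cosh t}<\cosh\frac{t}{\sqrt2}<\left(\cosh\frac{\sqrt6\,t}{4}\right)^{4/3}<I_0(t)<\left(\cosh\frac t2\right)^2<e^{t^2/4}.$$
   Context: $I_0(t)=\sum_{n=0}^{\infty}\frac{t^{2n}}{2^{2n}(n!)^2}$ denotes the modified Bessel function of the first kind of order $0$. *)

(* Defs.v *)
From Stdlib Require Import Factorial Reals.
From Coquelicot Require Import Coquelicot.
Open Scope R_scope.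

(* Modified Bessel function of the first kind of order 0.  The series converges
   for every real t (its terms are bounded by (t^2/4)^n / n!), so the default
   value that [Series] gives to a divergent series never occurs. *)
Definition I0 (t : R) : R :=
  Series (fun n : nat => t ^ (2 * n) / (2 ^ (2 * n) * INR (fact n) ^ 2)).

(* Main.v *)
Require Import Defs.
From Stdlib Require Import Factorial Reals Lra Lia.
From Coquelicot Require Import Coquelicot.
Open Scope R_scope.

(** All the inequalities are comparisons for the equation [(t u')' = t u], which
[I0] solves.  Let [F = exp phi] be positive with [phi 0 = 0], and put
[f = phi'].  The weighted Wronskian [t (I0' F - I0 F')] vanishes at [0], and its
derivative is [I0 * F * (t - f - t f' - t f ^ 2)].  If the last factor keeps one
sign on [(0, T)], so does the Wronskian, hence so does the derivative of
[ln I0 - phi], and [I0] stays on one side of [F] there ([I0_comparison]).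
Everything is therefore reduced to elementary choices of [F].

Take [F = cosh (p t) ^ r] with [r = 1 / (2 p ^ 2)], and let [y = 2 p t].  Up to a
positive factor, the quantity whose sign matters is
[(2 - r) y cosh y + r y - 2 sinh y].  It vanishes to third order at [0], and
its third derivative is [(4 - 3 r) cosh y + (2 - r) y sinh y]
([hyperbolic_sign]).  The two thresholds can be read off from this expression:
it is positive for all [y > 0] when [r <= 4 / 3], that is [p >= sqrt 6 / 4];
it is negative for all [y > 0] when [r >= 2], that is [p <= 1 / 2]; and it is
negative near [0] as soon as [r > 4 / 3].  This gives both sufficient conditions
and the necessity of [p >= sqrt 6 / 4].

The necessity of [p <= 1 / 2] is a matter of growth at infinity, since
[cosh (p t) ^ (1 / (2 p ^ 2)) <= exp (t / (2 p))].  The same comparison, with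
[F = cosh (k t) ^ (d / k)] for [d < 1] and small [k], shows that [I0]
eventually exceeds [exp (c t)] for each [c < 1] ([I0_growth]).

In the chain of bounds, the members other than [I0] are values at
[p = 1], [1 / sqrt 2], [sqrt 6 / 4], [1 / 2] and the limit [p -> 0] of one
family, which decreases in [p] ([ln_cosh_family_decr], [ln_cosh_lt_half_sqr]).
*)

(** * Signs from derivatives, and hyperbolic functions *)

Lemma pos_of_derive_pos (T : R) (u du : R -> R) :
  (forall t, 0 <= t < T -> is_derive u t (du t)) ->
  u 0 = 0 ->
  (forall t, 0 < t < T -> 0 < du t) ->
  forall t, 0 < t < T -> 0 < u t.
Proof.
intros Hd H0 Hpos t Ht.
destruct (MVT_cor2 u du 0 t) as [c [Hc Hct]].
- lra.
- intros x Hx; apply is_derive_Reals, Hd; lra.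
- assert (0 < du c) by (apply Hpos; lra).
  rewrite H0 in Hc; nra.
Qed.

Lemma cosh_pos (x : R) : 0 < cosh x.
Proof. unfold cosh; generalize (exp_pos x) (exp_pos (- x)); lra. Qed.

Lemma sinh_pos (x : R) : 0 < x -> 0 < sinh x.
Proof. intros Hx; rewrite <- sinh_0; now apply sinh_lt. Qed.

Lemma cosh_sqr (x : R) : cosh x ^ 2 = 1 + sinh x ^ 2.
Proof. unfold cosh, sinh; rewrite exp_Ropp; field; apply Rgt_not_eq, exp_pos. Qed.

Lemma cosh_double (x : R) : cosh (2 * x) = 2 * cosh x ^ 2 - 1.
Proof.
unfold cosh; replace (2 * x) with (x + x) by ring.
rewrite !exp_Ropp, exp_plus; field; apply Rgt_not_eq, exp_pos.
Qed.

Lemma sinh_double (x : R) : sinh (2 * x) = 2 * sinh x * cosh x.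
Proof.
unfold cosh, sinh; replace (2 * x) with (x + x) by ring.
rewrite !exp_Ropp, exp_plus; field; apply Rgt_not_eq, exp_pos.
Qed.

Lemma sinh_lt_cosh (x : R) : sinh x < cosh x.
Proof. unfold cosh, sinh; generalize (exp_pos (- x)); lra. Qed.

Lemma is_derive_cosh (x : R) : is_derive cosh x (sinh x).
Proof. apply is_derive_Reals, derivable_pt_lim_cosh. Qed.

Lemma is_derive_sinh (x : R) : is_derive sinh x (cosh x).
Proof. apply is_derive_Reals, derivable_pt_lim_sinh. Qed.

Lemma is_derive_ln_cosh (k t : R) :
  is_derive (fun t => ln (cosh (k * t))) t (k * (sinh (k * t) / cosh (k * t))).
Proof.
evar_last.
- apply (is_derive_comp ln (fun t => cosh (k * t))).
  + apply is_derive_Reals, derivable_pt_lim_ln, cosh_pos.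
  + apply (is_derive_comp cosh (fun t => k * t)).
    * apply is_derive_cosh.
    * auto_derive; [exact I | reflexivity].
- unfold scal; simpl; unfold mult; simpl; field.
  apply Rgt_not_eq, cosh_pos.
Qed.

Lemma is_derive_tanh (k t : R) :
  is_derive (fun t => sinh (k * t) / cosh (k * t)) t (k / cosh (k * t) ^ 2).
Proof.
assert (Hk : is_derive (fun t : R => k * t) t k).
{ auto_derive; [exact I | ring]. }
evar_last.
- apply (is_derive_div (fun t => sinh (k * t)) (fun t => cosh (k * t))).
  + apply (is_derive_comp sinh (fun t => k * t)); [apply is_derive_sinh | exact Hk].
  + apply (is_derive_comp cosh (fun t => k * t)); [apply is_derive_cosh | exact Hk].
  + apply Rgt_not_eq, cosh_pos.
- unfold scal, minus, plus, opp; simpl; unfold mult; simpl.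
  replace (k / (cosh (k * t) * (cosh (k * t) * 1))) with
   (k * (cosh (k * t) ^ 2 - sinh (k * t) ^ 2) / cosh (k * t) ^ 2).
  + field; apply Rgt_not_eq, cosh_pos.
  + rewrite cosh_sqr at 1; field; apply Rgt_not_eq, cosh_pos.
Qed.

(** * The differential equation of the Bessel function *)

(** [I0 t] is the power series with these coefficients, evaluated at
[t ^ 2 / 4]. *)
Definition bessel_coef (n : nat) : R := / INR (fact n) ^ 2.

Lemma bessel_coef_pos (n : nat) : 0 < bessel_coef n.
Proof. apply Rinv_0_lt_compat, pow_lt, INR_fact_lt_0. Qed.

(** This recurrence is the whole differential equation: it says that the series
[G] with these coefficients satisfies [(x G')' = G]. *)
Lemma bessel_coef_succ (n : nat) :
  INR (S n) * (INR (S n) * bessel_coef (S n)) = bessel_coef n.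
Proof.
unfold bessel_coef; rewrite fact_simpl, mult_INR; field.
split; [apply INR_fact_neq_0 | apply not_0_INR; lia].
Qed.

Lemma CV_radius_bessel_coef : CV_radius bessel_coef = p_infty.
Proof.
apply CV_radius_infinite_DAlembert.
- intros n; apply Rgt_not_eq, bessel_coef_pos.
- apply is_lim_seq_ext with (fun n => / INR (S n) * / INR (S n)).
  + intros n; rewrite <- (bessel_coef_succ n).
    assert (Hn : INR (S n) <> 0) by (apply not_0_INR; lia).
    generalize (bessel_coef_pos (S n)); intros Hc.
    replace (bessel_coef (S n) / _) with (/ INR (S n) * / INR (S n)) by (field; lra).
    symmetry; apply Rabs_pos_eq, Rlt_le.
    apply Rmult_lt_0_compat; apply Rinv_0_lt_compat, lt_0_INR; lia.
  + assert (Hl : is_lim_seq (fun n => / INR (S n)) 0).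
    { apply (is_lim_seq_incr_1 (fun n => / INR n)).
      apply (is_lim_seq_inv _ p_infty); [apply is_lim_seq_INR | discriminate]. }
    apply (is_lim_seq_mult _ _ _ _ 0 Hl Hl).
    unfold is_Rbar_mult; simpl; f_equal; f_equal; ring.
Qed.

Lemma I0_PSeries (t : R) : I0 t = PSeries bessel_coef (t ^ 2 / 4).
Proof.
unfold I0, PSeries; apply Series_ext; intros n; unfold bessel_coef.
unfold Rdiv; rewrite !pow_mult, Rpow_mult_distr, pow_inv.
replace (2 ^ 2) with 4 by ring.
field; split; [apply pow_nonzero; lra | apply INR_fact_neq_0].
Qed.

Definition dI0 (t : R) : R := t / 2 * PSeries (PS_derive bessel_coef) (t ^ 2 / 4).

Lemma is_derive_I0 (t : R) : is_derive I0 t (dI0 t).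
Proof.
apply is_derive_ext with (fun t => PSeries bessel_coef (t ^ 2 / 4)).
{ intros s; symmetry; apply I0_PSeries. }
apply (is_derive_comp (PSeries bessel_coef) (fun t => t ^ 2 / 4)).
- apply is_derive_PSeries; rewrite CV_radius_bessel_coef; exact I.
- auto_derive; [exact I | field].
Qed.

(** Writing the equation for [t I0'], rather than for the second derivative,
keeps it regular at the singular point [t = 0]. *)
Lemma bessel_equation (t : R) : is_derive (fun t => t * dI0 t) t (t * I0 t).
Proof.
set (b := PS_incr_1 (PS_derive bessel_coef)).
apply is_derive_ext with (fun t => 2 * PSeries b (t ^ 2 / 4)).
{ intros s; unfold b, dI0; rewrite PSeries_incr_1.
  unfold mult, plus; simpl; field. }
(* With [x = t ^ 2 / 4] we have [t I0' = 2 x G'(x)], and [b] is the sequence of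
   coefficients of [x G'(x)]. *)
assert (Hb : is_derive (PSeries b) (t ^ 2 / 4) (I0 t)).
{ rewrite I0_PSeries.
  rewrite (PSeries_ext bessel_coef (PS_derive b)).
  - apply is_derive_PSeries; unfold b.
    rewrite CV_radius_incr_1, CV_radius_derive, CV_radius_bessel_coef; exact I.
  - intros n; symmetry; apply bessel_coef_succ. }
evar_last.
- apply is_derive_scal.
  apply (is_derive_comp (PSeries b) (fun t => t ^ 2 / 4)); [exact Hb |].
  auto_derive; [exact I | reflexivity].
- unfold scal; simpl; unfold mult; simpl; field.
Qed.

Lemma I0_0 : I0 0 = 1.
Proof.
rewrite I0_PSeries; replace (0 ^ 2 / 4) with 0 by field.
rewrite PSeries_0; unfold bessel_coef; simpl; field.
Qed.

Lemma I0_pos (t : R) : 0 < I0 t.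
Proof.
rewrite I0_PSeries; unfold PSeries.
set (a := fun n => bessel_coef n * (t ^ 2 / 4) ^ n).
assert (Hx : 0 <= t ^ 2 / 4) by (generalize (pow2_ge_0 t); lra).
assert (Ha : ex_series a).
{ apply ex_series_Rabs, CV_disk_inside; rewrite CV_radius_bessel_coef; exact I. }
assert (Hpos : forall n, 0 <= a n).
{ intros n; apply Rmult_le_pos; [apply Rlt_le, bessel_coef_pos | now apply pow_le]. }
rewrite (Series_incr_1 a Ha).
apply Rplus_lt_le_0_compat.
- unfold a, bessel_coef; simpl; lra.
- replace 0 with (Series (fun n => 0 * a (S n))) by (rewrite Series_scal_l; ring).
  apply Series_le.
  + intros n; generalize (Hpos (S n)); lra.
  + now apply ex_series_incr_1 in Ha.
Qed.

(** * Comparison with the Bessel function *)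

(** The sign [sigma] (in practice [1] or [-1]) lets one argument treat lower and
upper bounds. *)
Lemma I0_comparison (sigma T : R) (phi f g : R -> R) :
  (forall t, is_derive phi t (f t)) ->
  (forall t, is_derive f t (g t)) ->
  phi 0 = 0 ->
  (forall t, 0 < t < T -> 0 < sigma * (t - f t - t * g t - t * f t ^ 2)) ->
  forall t, 0 < t < T -> 0 < sigma * (ln (I0 t) - phi t).
Proof.
intros Hphi Hf Hphi0 Hsub.
(* [Hw] concerns the Wronskian; dividing it by [t * I0 * exp phi] gives the
   derivative of [sigma * (ln I0 - phi)]. *)
assert (Hw : forall t, 0 < t < T ->
  0 < sigma * (exp (phi t) * (t * dI0 t - t * f t * I0 t))).
{ apply (pos_of_derive_pos T) with
    (du := fun t => sigma * (t - f t - t * g t - t * f t ^ 2) * (exp (phi t) * I0 t)).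
  - intros t _.
    evar_last.
    + apply is_derive_scal.
      apply (is_derive_mult (fun t => exp (phi t))
               (fun t => t * dI0 t - t * f t * I0 t)); [| | intros; apply Rmult_comm].
      * apply (is_derive_comp exp phi); [apply is_derive_Reals, derivable_pt_lim_exp | apply Hphi].
      * apply (is_derive_minus (fun t => t * dI0 t) (fun t => t * f t * I0 t)).
        -- apply bessel_equation.
        -- apply (is_derive_mult (fun t => t * f t) I0); [| apply is_derive_I0 | intros; apply Rmult_comm].
           apply (is_derive_mult (fun t => t) f); [apply @is_derive_id | apply Hf | intros; apply Rmult_comm].
    + unfold scal, minus, plus, opp, one; simpl; unfold mult; simpl; ring.
  - ring.
  - intros t Ht; apply Rmult_lt_0_compat; [now apply Hsub |].
    apply Rmult_lt_0_compat; [apply exp_pos | apply I0_pos]. }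
apply (pos_of_derive_pos T) with (du := fun t => sigma * (dI0 t / I0 t - f t)).
- intros t _.
  evar_last.
  + apply is_derive_scal.
    apply (is_derive_minus (fun t => ln (I0 t)) phi); [| apply Hphi].
    apply (is_derive_comp ln I0); [| apply is_derive_I0].
    apply is_derive_Reals, derivable_pt_lim_ln, I0_pos.
  + unfold scal, minus, plus, opp; simpl; unfold mult; simpl; field.
    apply Rgt_not_eq, I0_pos.
- rewrite Hphi0, I0_0, ln_1; ring.
- intros t Ht.
  replace (sigma * _) with
    (sigma * (exp (phi t) * (t * dI0 t - t * f t * I0 t)) / (exp (phi t) * t * I0 t)).
  + apply Rdiv_lt_0_compat; [now apply Hw |].
    repeat apply Rmult_lt_0_compat; [apply exp_pos | lra | apply I0_pos].
  + generalize (exp_pos (phi t)) (I0_pos t); intros; field; lra.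
Qed.

Lemma I0_comparison_cosh (sigma T m k : R) :
  (forall t, 0 < t < T ->
     let h := m * k * (sinh (k * t) / cosh (k * t)) in
     0 < sigma * (t - h - t * (m * k ^ 2 / cosh (k * t) ^ 2) - t * h ^ 2)) ->
  forall t, 0 < t < T -> 0 < sigma * (ln (I0 t) - m * ln (cosh (k * t))).
Proof.
intros H; apply I0_comparison with
  (f := fun t => m * k * (sinh (k * t) / cosh (k * t)))
  (g := fun t => m * k ^ 2 / cosh (k * t) ^ 2).
- intros t; evar_last.
  + apply is_derive_scal, is_derive_ln_cosh.
  + ring.
- intros t; evar_last.
  + apply is_derive_scal, is_derive_tanh.
  + field; apply Rgt_not_eq, cosh_pos.
- rewrite Rmult_0_r, cosh_0, ln_1; ring.
- exact H.
Qed.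

(** The function in the conclusion and its first two derivatives vanish at [0],
and the hypothesis concerns its third derivative. *)
Lemma hyperbolic_sign (sigma r Y : R) :
  (forall y, 0 < y < Y -> 0 < sigma * ((4 - 3 * r) * cosh y + (2 - r) * (y * sinh y))) ->
  forall y, 0 < y < Y -> 0 < sigma * ((2 - r) * (y * cosh y) + r * y - 2 * sinh y).
Proof.
intros H3.
assert (Hc := is_derive_cosh); assert (Hs := is_derive_sinh).
assert (Hyc : forall y, is_derive (fun y => y * cosh y) y (cosh y + y * sinh y)).
{ intros y; evar_last.
  - apply (is_derive_mult (fun y => y) cosh); [apply @is_derive_id | apply Hc | intros; apply Rmult_comm].
  - unfold plus, one; simpl; unfold mult; simpl; ring. }
assert (Hys : forall y, is_derive (fun y => y * sinh y) y (sinh y + y * cosh y)).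
{ intros y; evar_last.
  - apply (is_derive_mult (fun y => y) sinh); [apply @is_derive_id | apply Hs | intros; apply Rmult_comm].
  - unfold plus, one; simpl; unfold mult; simpl; ring. }
assert (H2 : forall y, 0 < y < Y ->
  0 < sigma * ((2 - r) * (y * cosh y) + (2 - 2 * r) * sinh y)).
{ refine (pos_of_derive_pos Y _ _ _ _ H3).
  - intros y _; evar_last.
    + apply is_derive_scal.
      apply (is_derive_plus (fun y => (2 - r) * (y * cosh y)) (fun y => (2 - 2 * r) * sinh y));
        apply is_derive_scal; [apply Hyc | apply Hs].
    + unfold plus; simpl; ring.
  - rewrite sinh_0; ring. }
assert (H1 : forall y, 0 < y < Y ->
  0 < sigma * ((2 - r) * (y * sinh y) - r * cosh y + r)).
{ refine (pos_of_derive_pos Y _ _ _ _ H2).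
  - intros y _; evar_last.
    + apply is_derive_scal.
      apply (is_derive_plus (fun y => (2 - r) * (y * sinh y) - r * cosh y) (fun y => r));
        [| apply @is_derive_const].
      apply (is_derive_minus (fun y => (2 - r) * (y * sinh y)) (fun y => r * cosh y));
        apply is_derive_scal; [apply Hys | apply Hc].
    + unfold plus, minus, plus, opp, zero; simpl; ring.
  - rewrite cosh_0, sinh_0; ring. }
refine (pos_of_derive_pos Y _ _ _ _ H1).
- intros y _; evar_last.
  + apply is_derive_scal.
    apply (is_derive_minus (fun y => (2 - r) * (y * cosh y) + r * y) (fun y => 2 * sinh y));
      [| apply is_derive_scal, Hs].
    apply (is_derive_plus (fun y => (2 - r) * (y * cosh y)) (fun y => r * y));
      apply is_derive_scal; [apply Hyc | apply @is_derive_id].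
  + unfold minus, plus, opp, one; simpl; ring.
- rewrite cosh_0, sinh_0; ring.
Qed.

(** For [phi = m ln (cosh (p t))] the comparison expression starts with
[(1 - 2 m p ^ 2) t] at [0].  The exponent [m = 1 / (2 p ^ 2)] cancels this term,
and the sign is then decided by the next order. *)
Lemma I0_comparison_cosh_power (sigma Y p : R) :
  0 < p ->
  (let r := 1 / (2 * p ^ 2) in
   forall y, 0 < y < Y -> 0 < sigma * ((4 - 3 * r) * cosh y + (2 - r) * (y * sinh y))) ->
  forall t, 0 < t -> 2 * p * t < Y ->
    0 < sigma * (ln (I0 t) - 1 / (2 * p ^ 2) * ln (cosh (p * t))).
Proof.
intros Hp Hsign t Ht HtY.
apply (I0_comparison_cosh sigma (Y / (2 * p))).
- intros s Hs; cbv zeta.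
  assert (HsY : 0 < 2 * (p * s) < Y).
  { split; [nra |].
    replace Y with (2 * p * (Y / (2 * p))) by (field; lra); nra. }
  generalize (hyperbolic_sign sigma _ Y Hsign (2 * (p * s)) HsY).
  generalize (cosh_sqr (p * s)) (cosh_pos (p * s)).
  rewrite cosh_double, sinh_double.
  set (C := cosh (p * s)); set (S := sinh (p * s)); intros HCS HC Hh.
  (* The double-angle formulas turn the expression in [2 p s] into
     [8 p cosh (p s) ^ 2] times the one required by the comparison. *)
  match type of Hh with 0 < ?e =>
    match goal with |- 0 < ?g =>
      replace g with (e / (8 * p * C ^ 2)) end end.
  + apply Rdiv_lt_0_compat; [exact Hh | nra].
  + assert (HS : S ^ 2 = C ^ 2 - 1) by lra.
    unfold Rdiv; rewrite !Rpow_mult_distr, HS; field; lra.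
- split; [exact Ht |].
  apply Rmult_lt_reg_l with (2 * p); [lra |].
  replace (2 * p * (Y / (2 * p))) with Y by (field; lra); lra.
Qed.

(** * Monotonicity of the comparison family in its parameter *)

(** Two differentiations in [t] remove the logarithms: both sides agree to first
order at [0], and their second derivatives are [1 / (2 cosh (b t) ^ 2)] and
[1 / (2 cosh (a t) ^ 2)]. *)
Lemma ln_cosh_family_decr (a b t : R) :
  0 < a < b -> 0 < t ->
  1 / (2 * b ^ 2) * ln (cosh (b * t)) < 1 / (2 * a ^ 2) * ln (cosh (a * t)).
Proof.
intros Hab Ht.
set (T := t + 1).
assert (H2 : forall s, 0 < s < T ->
  0 < 1 / (2 * a) * (sinh (a * s) / cosh (a * s)) - 1 / (2 * b) * (sinh (b * s) / cosh (b * s))).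
{ apply (pos_of_derive_pos T) with
    (du := fun s => / 2 * (/ cosh (a * s) ^ 2 - / cosh (b * s) ^ 2)).
  - intros s _; evar_last.
    + apply (is_derive_minus
        (fun s => 1 / (2 * a) * (sinh (a * s) / cosh (a * s)))
        (fun s => 1 / (2 * b) * (sinh (b * s) / cosh (b * s))));
      apply is_derive_scal, is_derive_tanh.
    + generalize (cosh_pos (a * s)) (cosh_pos (b * s)); intros.
      unfold minus, plus, opp; simpl; field; lra.
  - rewrite !Rmult_0_r, sinh_0, cosh_0; field; lra.
  - intros s Hs.
    assert (Hlt : sinh (a * s) < sinh (b * s)) by (apply sinh_lt; nra).
    assert (0 < sinh (a * s)) by (apply sinh_pos; nra).
    assert (/ cosh (b * s) ^ 2 < / cosh (a * s) ^ 2).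
    { apply Rinv_lt_contravar.
      - apply Rmult_lt_0_compat; apply pow_lt, cosh_pos.
      - rewrite !cosh_sqr; nra. }
    lra. }
apply Rlt_0_minus.
refine (pos_of_derive_pos T
  (fun s => 1 / (2 * a ^ 2) * ln (cosh (a * s)) - 1 / (2 * b ^ 2) * ln (cosh (b * s)))
  _ _ _ H2 t _).
- intros s _; evar_last.
  + apply (is_derive_minus
      (fun s => 1 / (2 * a ^ 2) * ln (cosh (a * s)))
      (fun s => 1 / (2 * b ^ 2) * ln (cosh (b * s))));
    apply is_derive_scal, is_derive_ln_cosh.
  + generalize (cosh_pos (a * s)) (cosh_pos (b * s)); intros.
    unfold minus, plus, opp; simpl; field; lra.
- rewrite !Rmult_0_r, cosh_0, ln_1; ring.
- unfold T; lra.
Qed.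

Lemma tanh_lt_id (x : R) : 0 < x -> sinh x / cosh x < x.
Proof.
intros Hx; apply Rlt_0_minus.
rewrite <- (Rmult_1_l x) at 2 3.
apply (pos_of_derive_pos (x + 1) (fun s => s - sinh (1 * s) / cosh (1 * s))
         (fun s => 1 - 1 / cosh (1 * s) ^ 2)).
- intros s _.
  apply (is_derive_minus (fun s => s) (fun s => sinh (1 * s) / cosh (1 * s)));
    [apply @is_derive_id | apply is_derive_tanh].
- rewrite Rmult_0_r, sinh_0, cosh_0; field.
- intros s Hs.
  assert (0 < sinh (1 * s)) by (apply sinh_pos; lra).
  generalize (cosh_pos (1 * s)); intros HC.
  replace (1 - _) with ((cosh (1 * s) ^ 2 - 1) / cosh (1 * s) ^ 2) by (field; lra).
  apply Rdiv_lt_0_compat; [rewrite cosh_sqr |]; nra.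
- lra.
Qed.

(** This bounds the family by its limit [exp (t ^ 2 / 4)] as the parameter tends
to [0]. *)
Lemma ln_cosh_lt_half_sqr (x : R) : 0 < x -> ln (cosh x) < x ^ 2 / 2.
Proof.
intros Hx; apply Rlt_0_minus.
rewrite <- (Rmult_1_l x) at 2.
apply (pos_of_derive_pos (x + 1) (fun s => s ^ 2 / 2 - ln (cosh (1 * s)))
         (fun s => s - sinh (1 * s) / cosh (1 * s))).
- intros s _; evar_last.
  + apply (is_derive_minus (fun s => s ^ 2 / 2) (fun s => ln (cosh (1 * s)))).
    * auto_derive; [exact I | reflexivity].
    * apply is_derive_ln_cosh.
  + unfold minus, plus, opp; simpl; field; apply Rgt_not_eq, cosh_pos.
- rewrite Rmult_0_r, cosh_0, ln_1; field.
- intros s Hs; rewrite Rmult_1_l; generalize (tanh_lt_id s (proj1 Hs)); lra.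
- lra.
Qed.

(** * Growth at infinity *)

Lemma ln_cosh_le (x : R) : 0 < x -> ln (cosh x) <= x.
Proof.
intros Hx; rewrite <- (ln_exp x) at 2.
apply ln_le; [apply cosh_pos |].
generalize (sinh_pos x Hx); unfold sinh, cosh; lra.
Qed.

Lemma ln_cosh_ge (x : R) : x - ln 2 <= ln (cosh x).
Proof.
rewrite <- (ln_exp x) at 1; rewrite <- ln_div; [| apply exp_pos | lra].
generalize (exp_pos x) (exp_pos (- x)); intros.
apply ln_le; unfold cosh; lra.
Qed.

(** For [phi = (d / k) ln (cosh (k t))] one has [phi' <= d], [phi' <= d k t] and
[phi'' <= d k].  Hence the comparison condition holds for every [t] once
[2 d k + d ^ 2 < 1], while [phi] grows like [d t] with [d > c]. *)
Lemma I0_growth (c : R) : 0 < c < 1 -> exists t, 0 < t /\ c * t < ln (I0 t).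
Proof.
intros Hc.
set (d := (1 + c) / 2).
assert (Hd : 0 < d < 1 /\ 0 < d - c) by (unfold d; lra).
set (k := (1 - d ^ 2) / 4).
assert (Hk : 0 < k) by (unfold k; nra).
assert (Hln2 : 0 < ln 2) by (rewrite <- ln_1; apply ln_increasing; lra).
(* The time at which the lower bound [d t - (d / k) ln 2] of [phi] equals
   [c t]. *)
set (t := d / k * ln 2 / (d - c)).
assert (Ht : 0 < t).
{ unfold t; apply Rdiv_lt_0_compat; [| lra].
  apply Rmult_lt_0_compat; [apply Rdiv_lt_0_compat |]; lra. }
exists t; split; [exact Ht |].
assert (Hcmp : 0 < 1 * (ln (I0 t) - d / k * ln (cosh (k * t)))).
{ apply (I0_comparison_cosh 1 (t + 1)); [| lra].
  intros s Hs; cbv zeta.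
  assert (Hks : 0 < k * s) by nra.
  generalize (tanh_lt_id (k * s) Hks) (sinh_pos (k * s) Hks) (sinh_lt_cosh (k * s))
    (cosh_sqr (k * s)) (cosh_pos (k * s)).
  set (C := cosh (k * s)); set (S := sinh (k * s)); intros Htk HS HSC HCS HC.
  assert (Hth0 : 0 < S / C) by (apply Rdiv_lt_0_compat; lra).
  assert (Hth1 : S / C < 1) by (apply Rlt_div_l; lra).
  replace (d / k * k) with d by (field; lra).
  replace (d / k * k ^ 2) with (d * k) by (field; lra).
  set (h := d * (S / C)).
  assert (Hh : 0 < h < d) by (unfold h; split; nra).
  assert (Hhs : h <= d * k * s) by (unfold h; nra).
  assert (Hh' : d * k / C ^ 2 <= d * k).
  { assert (0 < d * k) by (apply Rmult_lt_0_compat; lra).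
    apply Rle_div_l; nra. }
  assert (s * (d * k / C ^ 2) <= s * (d * k)) by (apply Rmult_le_compat_l; lra).
  assert (s * h ^ 2 <= s * d ^ 2) by (apply Rmult_le_compat_l; nra).
  assert (Hlead : 0 < s * ((1 - d ^ 2) * (1 - d / 2))).
  { repeat apply Rmult_lt_0_compat; nra. }
  replace (s * ((1 - d ^ 2) * (1 - d / 2))) with (s - 2 * (d * k * s) - s * d ^ 2) in Hlead
    by (unfold k; field).
  lra. }
assert (Hlow : d * t - d / k * ln 2 <= d / k * ln (cosh (k * t))).
{ replace (d * t - d / k * ln 2) with (d / k * (k * t - ln 2)) by (field; lra).
  apply Rmult_le_compat_l; [| apply ln_cosh_ge].
  apply Rlt_le, Rdiv_lt_0_compat; lra. }
assert (Hbal : c * t = d * t - d / k * ln 2) by (unfold t; field; lra).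
lra.
Qed.

(** * The two thresholds *)

Lemma I0_gt_of_ge (p t : R) : 0 < p -> 3 / 8 <= p ^ 2 -> 0 < t ->
  1 / (2 * p ^ 2) * ln (cosh (p * t)) < ln (I0 t).
Proof.
intros Hp Hp2 Ht.
assert (Hr : 0 < 1 / (2 * p ^ 2) <= 4 / 3).
{ split; [apply Rdiv_lt_0_compat | apply Rle_div_l]; lra. }
enough (0 < 1 * (ln (I0 t) - 1 / (2 * p ^ 2) * ln (cosh (p * t)))) by lra.
apply (I0_comparison_cosh_power 1 (2 * p * t + 1)); [exact Hp | | exact Ht | lra].
cbv zeta; intros y Hy.
assert (0 < y * sinh y) by (apply Rmult_lt_0_compat; [| apply sinh_pos]; lra).
generalize (cosh_pos y); nra.
Qed.

Lemma I0_lt_of_le (p t : R) : 0 < p <= 1 / 2 -> 0 < t ->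
  ln (I0 t) < 1 / (2 * p ^ 2) * ln (cosh (p * t)).
Proof.
intros Hp Ht.
assert (Hr : 2 <= 1 / (2 * p ^ 2)) by (apply Rle_div_r; nra).
enough (0 < -1 * (ln (I0 t) - 1 / (2 * p ^ 2) * ln (cosh (p * t)))) by lra.
apply (I0_comparison_cosh_power (-1) (2 * p * t + 1)); [lra | | exact Ht | lra].
cbv zeta; intros y Hy.
assert (0 < y * sinh y) by (apply Rmult_lt_0_compat; [| apply sinh_pos]; lra).
generalize (cosh_pos y); nra.
Qed.

(** The third derivative of [hyperbolic_sign] tends to [4 - 3 r < 0] at [0], and
since [y sinh y < y cosh y] it stays negative for [y < 3 r - 4]. *)
Lemma I0_lt_near_0 (p : R) : 0 < p -> p ^ 2 < 3 / 8 ->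
  exists t, 0 < t /\ ln (I0 t) < 1 / (2 * p ^ 2) * ln (cosh (p * t)).
Proof.
intros Hp Hp2.
set (r := 1 / (2 * p ^ 2)).
assert (Hr : 4 / 3 < r).
{ assert (0 < p ^ 2) by now apply pow_lt.
  unfold r; apply -> Rlt_div_r; lra. }
set (t := (3 * r - 4) / (4 * p)).
assert (Ht : 0 < t) by (unfold t; apply Rdiv_lt_0_compat; lra).
exists t; split; [exact Ht |].
enough (0 < -1 * (ln (I0 t) - r * ln (cosh (p * t)))) by lra.
apply (I0_comparison_cosh_power (-1) (3 * r - 4)); [exact Hp | | exact Ht |].
- fold r; cbv zeta; intros y Hy.
  generalize (sinh_pos y (proj1 Hy)) (sinh_lt_cosh y); intros HS HSC.
  assert (0 < y * sinh y) by nra.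
  assert (y * sinh y < (3 * r - 4) * cosh y).
  { apply Rlt_trans with (y * cosh y);
      [apply Rmult_lt_compat_l | apply Rmult_lt_compat_r]; lra. }
  nra.
- replace (2 * p * t) with ((3 * r - 4) / 2) by (unfold t; field; lra); lra.
Qed.

Lemma I0_gt_far (p : R) : 1 / 2 < p ->
  exists t, 0 < t /\ 1 / (2 * p ^ 2) * ln (cosh (p * t)) < ln (I0 t).
Proof.
intros Hp.
destruct (I0_growth (1 / (2 * p))) as [t [Ht HI]].
{ split; [apply Rdiv_lt_0_compat | apply Rlt_div_l]; lra. }
exists t; split; [exact Ht |].
apply Rle_lt_trans with (2 := HI).
replace (1 / (2 * p) * t) with (1 / (2 * p ^ 2) * (p * t)) by (field; lra).
apply Rmult_le_compat_l.
- apply Rlt_le, Rdiv_lt_0_compat; nra.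
- apply ln_cosh_le; nra.
Qed.

(** * Real powers in terms of logarithms *)

Lemma Rpower_lt_ln (x y z : R) : 0 < z -> Rpower x y < z <-> y * ln x < ln z.
Proof.
intros Hz; unfold Rpower; split; intros H.
- rewrite <- (ln_exp (y * ln x)); apply ln_increasing; [apply exp_pos | exact H].
- rewrite <- (exp_ln z Hz); now apply exp_increasing.
Qed.

Lemma lt_Rpower_ln (x y z : R) : 0 < z -> z < Rpower x y <-> ln z < y * ln x.
Proof.
intros Hz; unfold Rpower; split; intros H.
- rewrite <- (ln_exp (y * ln x)); now apply ln_increasing.
- rewrite <- (exp_ln z Hz); now apply exp_increasing.
Qed.

Lemma Rpower_lt_Rpower_ln (x y x' y' : R) :
  y * ln x < y' * ln x' -> Rpower x y < Rpower x' y'.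
Proof. apply exp_increasing. Qed.

Theorem theorem6 :
  (forall p : R, 0 < p ->
     ((forall t : R, 0 < t -> I0 t > Rpower (cosh (p * t)) (1 / (2 * p ^ 2)))
        <-> p >= sqrt 6 / 4)
     /\
     ((forall t : R, 0 < t -> I0 t < Rpower (cosh (p * t)) (1 / (2 * p ^ 2)))
        <-> 0 < p <= 1 / 2))
  /\
  (forall t : R, 0 < t ->
     sqrt (cosh t) < cosh (t / sqrt 2)
     /\ cosh (t / sqrt 2) < Rpower (cosh (sqrt 6 * t / 4)) (4 / 3)
     /\ Rpower (cosh (sqrt 6 * t / 4)) (4 / 3) < I0 t
     /\ I0 t < (cosh (t / 2)) ^ 2
     /\ (cosh (t / 2)) ^ 2 < exp (t ^ 2 / 4)).
Proof.
assert (H6 : sqrt 6 ^ 2 = 6) by (apply pow2_sqrt; lra).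
assert (H6p : 0 < sqrt 6) by (apply sqrt_lt_R0; lra).
split.
- intros p Hp; split; split.
  + intros Hall; destruct (Rle_or_lt (sqrt 6 / 4) p) as [Hle | Hlt]; [lra |].
    destruct (I0_lt_near_0 p Hp) as [t [Ht HI]]; [nra |].
    apply lt_Rpower_ln in HI; [| apply I0_pos].
    specialize (Hall t Ht); lra.
  + intros Hge t Ht; apply Rpower_lt_ln; [apply I0_pos |].
    apply I0_gt_of_ge; [exact Hp | nra | exact Ht].
  + intros Hall; destruct (Rle_or_lt p (1 / 2)) as [Hle | Hlt]; [lra |].
    destruct (I0_gt_far p Hlt) as [t [Ht HI]].
    apply Rpower_lt_ln in HI; [| apply I0_pos].
    specialize (Hall t Ht); lra.
  + intros Hle t Ht; apply lt_Rpower_ln; [apply I0_pos |].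
    now apply I0_lt_of_le.
- intros t Ht.
  assert (H2 : sqrt 2 ^ 2 = 2) by (apply pow2_sqrt; lra).
  assert (H2p : 0 < sqrt 2) by (apply sqrt_lt_R0; lra).
  set (a := / sqrt 2).
  assert (Ha : 0 < a) by now apply Rinv_0_lt_compat.
  assert (Ha2 : a ^ 2 = 1 / 2).
  { unfold a; rewrite pow_inv, H2; field. }
  replace (t / sqrt 2) with (a * t) by (unfold a; field; lra).
  set (b := sqrt 6 / 4).
  assert (Hb : 0 < b) by (unfold b; lra).
  assert (Hb2 : b ^ 2 = 3 / 8).
  { unfold b; unfold Rdiv; rewrite Rpow_mult_distr, H6; field. }
  replace (sqrt 6 * t / 4) with (b * t) by (unfold b; field).
  replace (4 / 3) with (1 / (2 * b ^ 2)) by (rewrite Hb2; field).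
  repeat split.
  + rewrite <- Rpower_sqrt, <- (Rpower_1 (cosh (a * t))) by apply cosh_pos.
    apply Rpower_lt_Rpower_ln.
    generalize (ln_cosh_family_decr a 1 t ltac:(nra) Ht).
    rewrite Ha2, Rmult_1_l; lra.
  + rewrite <- (Rpower_1 (cosh (a * t))) by apply cosh_pos.
    apply Rpower_lt_Rpower_ln.
    generalize (ln_cosh_family_decr b a t ltac:(nra) Ht).
    rewrite Ha2; lra.
  + apply Rpower_lt_ln; [apply I0_pos |].
    apply I0_gt_of_ge; lra.
  + replace (t / 2) with (1 / 2 * t) by field.
    rewrite <- (Rpower_pow 2) by apply cosh_pos.
    apply lt_Rpower_ln; [apply I0_pos |].
    replace (INR 2) with (1 / (2 * (1 / 2) ^ 2)) by (simpl; field).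
    apply I0_lt_of_le; lra.
  + rewrite <- (Rpower_pow 2) by apply cosh_pos.
    apply exp_increasing.
    generalize (ln_cosh_lt_half_sqr (t / 2)); simpl; lra.
Qed.
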